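(* Let $E$ be a finite-dimensional Banach space. If a set function $\nu\colon\mathcal B_E\to[0,+\infty)$ satisfies axioms (A1), (A2), (A4) and (A5), then it also satisfies axiom (A3).
   Context: $E$ is a real or complex Banach space; $\mathcal B_E$ denotes the family of all non-empty bounded subsets of $E$, and $\mathcal K_E\subseteq\mathcal B_E$ the subfamily of relatively compact sets. $\operatorname{conv}A$ is the (not necessarily closed) convex hull; $A+B=\{a+b: a\in A, b\in B\}$, $\lambda A=\{\lambda a: a\in A\}$. For $\nu\colon\mathcal B_E\to[0,+\infty)$ put $\ker\nu=\{A\in\mathcal B_E:\nu(A)=0\}$. The axioms are: (A1) $\ker\nu$ is non-empty and $\ker\nu\subseteq\mathcal K_E$; (A2) for all $A,B\in\mathcal B_E$, if $A\subseteq B$ then $\nu(A)\le\nu(B)$; (A3) $\nu(\operatorname{conv}A)=\nu(A)$ for all $A\in\mathcal B_E$; (A4) $\nu(\lambda A+(1-\lambda)B)\le\lambda\nu(A)+(1-\lambda)\nu(B)$ for all $A,B\in\mathcal B_E$ and all $\lambda\in[0,1]$; (A5) if $A_n\in\mathcal B_E$ ($n\in\mathbb N$) are closed, $A_{n+1}\subseteq A_n$ for all $n$, and $\nu(A_n)\to0$, then $\bigcap_{n=1}^\infty A_n\ne\emptyset$. *)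

(* Defs.v *)
(* MathComp + MathComp-Analysis *)
From HB Require Import structures.
From mathcomp Require Import all_boot all_order all_algebra.
From mathcomp Require Import all_classical all_reals all_analysis.
From mathcomp Require Export complex.
Set Implicit Arguments.
Unset Strict Implicit.
Unset Printing Implicit Defensive.
Import Order.TTheory GRing.Theory Num.Theory.
Import numFieldNormedType.Exports.
Local Open Scope classical_set_scope.
Local Open Scope ring_scope.

Definition finite_dimensional (K : numFieldType) (E : lmodType K) : Prop :=
  exists (n : nat) (b : 'I_n -> E),
    forall x : E, exists c : 'I_n -> K, x = \sum_(i < n) c i *: b i.

(* B_E; its subfamily K_E is [relatively_compact_family]. *)
Definition bounded_family (K : numFieldType) (E : normedModType K) :
    set (set E) :=
  [set A | A !=set0 /\ bounded_set A].

Definition relatively_compact_family (K : numFieldType)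
    (E : normedModType K) : set (set E) :=
  [set A | bounded_family A /\ compact (closure A)].

(* The weights occurring in [convex_set] lie in [{i01 K}]; for K = R[i] this
   type consists of the real numbers of [0, 1], because 0 <= z in R[i] forces
   z to be real. *)
Definition convex_hull (K : numFieldType) (E : lmodType K) (A : set E) : set E :=
  smallest (@convex_set K E) A.

Definition set_add (V : zmodType) (A B : set V) : set V :=
  [set a + b | a in A & b in B].

Definition set_scale (K : numFieldType) (E : lmodType K) (k : K) (A : set E) :
    set E :=
  [set k *: a | a in A].

(* A function from B_E to [0, +oo[ is represented by a total function on
   [set E], none of whose values outside B_E are ever constrained. *)
Definition nonneg_on_bounded (R : realType) (K : numFieldType)
    (E : normedModType K) (nu : set E -> R) : Prop :=
  forall A, bounded_family A -> 0 <= nu A.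

(* ker nu *)
Definition null_family (R : realType) (K : numFieldType) (E : normedModType K)
    (nu : set E -> R) : set (set E) :=
  [set A | bounded_family A /\ nu A = 0].

Definition A1 (R : realType) (K : numFieldType) (E : normedModType K)
    (nu : set E -> R) : Prop :=
  null_family nu !=set0 /\ null_family nu `<=` @relatively_compact_family K E.

Definition A2 (R : realType) (K : numFieldType) (E : normedModType K)
    (nu : set E -> R) : Prop :=
  forall A B, bounded_family A -> bounded_family B ->
    A `<=` B -> nu A <= nu B.

Definition A3 (R : realType) (K : numFieldType) (E : normedModType K)
    (nu : set E -> R) : Prop :=
  forall A, bounded_family A -> nu (convex_hull A) = nu A.

(* [iota] is the inclusion of the reals into the scalar field: [idfun] for
   K = R and [real_complex R] for K = R[i]. *)
Definition A4 (R : realType) (K : numFieldType) (iota : R -> K)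
    (E : normedModType K) (nu : set E -> R) : Prop :=
  forall (A B : set E) (t : R), bounded_family A -> bounded_family B ->
    0 <= t <= 1 ->
    nu (set_add (set_scale (iota t) A) (set_scale (iota (1 - t)) B))
      <= t * nu A + (1 - t) * nu B.

Definition A5 (R : realType) (K : numFieldType) (E : normedModType K)
    (nu : set E -> R) : Prop :=
  forall A : nat -> set E,
    (forall n, bounded_family (A n)) -> (forall n, closed (A n)) ->
    (forall n, A n.+1 `<=` A n) ->
    nu (A n) @[n --> \oo] --> (0 : R) ->
    \bigcap_n A n !=set0.

(* Main.v *)
Require Import Defs.
From HB Require Import structures.
From mathcomp Require Import all_boot all_order all_algebra.
From mathcomp Require Import all_classical all_reals all_analysis.
From mathcomp Require Import complex.
From mathcomp Require Import lra.
Import Order.TTheory GRing.Theory Num.Theory.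
Import numFieldNormedType.Exports.
Local Open Scope classical_set_scope.
Local Open Scope ring_scope.
Local Open Scope complex_scope.

(** Write [M] for a bound of the norm on [A], and [A_n] for the average
    (A + ... + A) / n with n summands. Convexity of [nu] gives
    nu(A_(n+1)) <= n/(n+1) nu(A_n) + 1/(n+1) nu(A), hence nu(A_n) <= nu(A) for
    all n >= 1 ([nu_average_le]). So it is enough to compare conv A with A_n.

    In finite dimension conv A lies within distance C/n of A_n, where C depends
    only on [M] and the dimension ([convex_hull_near_average]). By
    Caratheodory's theorem a point x of conv A is a combination of at most
    N + 1 points of [A], N being the length of a real spanning family; multiply the weights by n
    and round them to integers of sum n. This changes n x by a vector of norm
    at most C, and turns it into a sum of n points of [A].

    Finally, if y is in A_n and |n (x - y)| <= C, then
      x = (1 - 1/n) y + (1/n) (y + n (x - y)),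
    and the second point lies in the fixed ball [B] of radius M + C. Thus
    conv A is contained in (1 - 1/n) A_n + (1/n) B, and monotonicity and
    convexity of [nu] give
      nu(conv A) <= (1 - 1/n) nu(A) + (1/n) nu(B)
    for every n. Letting n tend to infinity yields nu(conv A) <= nu(A); the
    converse inequality is monotonicity ([A2_A4_convex_hull]).

    Real and complex scalars are treated together, through the inclusion
    [iota] of the reals into the field of scalars: convex combinations have
    real weights, so the dimension that matters is the real one, at most twice
    the length of a complex spanning family. *)

Set Implicit Arguments.
Unset Strict Implicit.
Unset Printing Implicit Defensive.

(** * Caratheodory's theorem with real weights *)

(** More than [d] vectors of a [d]-dimensional space are dependent, because the
    matrix having them as rows has a nonzero left kernel. The coefficients are
    extended by zero outside [S], ready to be subtracted from weights. *)
Lemma linear_dependence (F : fieldType) (d : nat) (I : finType)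
    (S : {set I}) (f : I -> 'rV[F]_d) :
  (d < #|S|)%N ->
  exists2 mu : I -> F, (exists2 i, i \in S & mu i != 0) &
    (forall i, i \notin S -> mu i = 0) /\ \sum_i mu i *: f i = 0.
Proof.
move=> dS; pose M := \matrix_(k < #|S|) f (enum_val k).
have : kermx M != 0.
  rewrite -mxrank_eq0 mxrank_ker subn_eq0 -ltnNge.
  exact: leq_ltn_trans (rank_leq_col M) dS.
case/rowV0Pn => v /sub_kermxP vM v0.
pose mu i := \sum_k v 0 k * (enum_val k == i)%:R.
have muE k : mu (enum_val k) = v 0 k.
  rewrite /mu (bigD1 k) //= eqxx mulr1 big1 ?addr0 // => l lk.
  by rewrite (inj_eq enum_val_inj) (negbTE lk) mulr0.
exists mu; last split.
- have /rV0Pn[k vk] := v0; exists (enum_val k); first exact: enum_valP.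
  by rewrite muE.
- move=> i iS; rewrite /mu big1 // => k _.
  case: eqP => [ki|_]; last by rewrite mulr0.
  by rewrite -ki enum_valP in iS.
- rewrite -[RHS]vM mulmx_sum_row.
  under eq_bigr do rewrite scaler_suml.
  rewrite exchange_big; apply: eq_bigr => k _ /=.
  rewrite (bigD1 (enum_val k)) //= eqxx mulr1 rowK big1 ?addr0 // => i ik.
  by rewrite eq_sym (negbTE ik) mulr0 scale0r.
Qed.

(** A spanning family over the real numbers, also when the scalars are complex;
    [N] bounds the real dimension of [E]. *)
Definition real_spanned (R : realType) (K : numFieldType) (iota : R -> K)
    (E : lmodType K) (N : nat) : Prop :=
  exists b : 'I_N -> E,
    forall x : E, exists c : 'I_N -> R, x = \sum_(i < N) iota (c i) *: b i.

Definition support_of (R : realType) (I : finType) (w : I -> R) : {set I} :=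
  [set i | w i != 0].

(** If more than N + 1 weights are nonzero, the corresponding vectors (a i, 1)
    satisfy a real linear relation [mu]. Subtracting t mu from the weights
    preserves both sums, and the largest [t] that keeps them nonnegative makes
    one of them vanish. Keeping the family [a] and changing only the
    weights avoids any reindexing. *)
Lemma caratheodory (R : realType) (K : numFieldType)
    (iota : {rmorphism R -> K}) (E : lmodType K) (N : nat)
    (I : finType) (a : I -> E) (w : I -> R) :
  real_spanned iota E N -> (forall i, 0 <= w i) ->
  exists w' : I -> R, [/\ (forall i, 0 <= w' i), (#|support_of w'| <= N.+1)%N,
    \sum_i w' i = \sum_i w i &
    \sum_i iota (w' i) *: a i = \sum_i iota (w i) *: a i].
Proof.
case=> b /choice[c cE].
have [n] := ubnP #|support_of w|; elim: n w => // n IH w wn w0.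
have [wN|Nw] := leqP #|support_of w| N.+1; first by exists w.
(* The last coordinate, equal to 1, makes relations between the [f i] affine
   relations between the [a i]. *)
pose f i : 'rV[R]_(N + 1) := row_mx (\row_j c (a i) j) (const_mx 1).
have [|mu [i0 i0S mui0] [muS]] :=
  @linear_dependence R (N + 1) I (support_of w) f.
  by rewrite addn1.
move=> muf.
have mu1 : \sum_i mu i = 0.
  have : (\sum_i mu i *: f i) 0 (rshift N 0) = 0 by rewrite muf mxE.
  rewrite summxE => mufN; rewrite -[RHS]mufN; apply: eq_bigr => i _.
  by rewrite mxE row_mxEr mxE mulr1.
have mua : \sum_i iota (mu i) *: a i = 0.
  under eq_bigr do rewrite (cE (a _)) scaler_sumr.
  rewrite exchange_big big1 //= => j _.
  under eq_bigr do rewrite scalerA -rmorphM.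
  rewrite -scaler_suml -rmorph_sum.
  have : (\sum_i mu i *: f i) 0 (lshift 1 j) = 0 by rewrite muf mxE.
  rewrite summxE => mufj; rewrite [X in iota X](_ : _ = 0).
    by rewrite rmorph0 scale0r.
  by rewrite -[RHS]mufj; apply: eq_bigr => i _; rewrite mxE row_mxEl mxE.
have [i1 mui1] : exists i, 0 < mu i.
  apply/existsP; apply: contraT => /existsPn mule0; case/eqP: mui0.
  have /eqP := mu1; rewrite -oppr_eq0 -sumrN psumr_eq0.
    by move=> /allP/(_ i0 (mem_index_enum _)) /=; rewrite oppr_eq0 => /eqP.
  by move=> i _; rewrite oppr_ge0 leNgt mule0.
(* The index [j] realizes the largest admissible step [t]. *)
pose j := [arg min_(i < i1 | 0 < mu i) (w i / mu i)]%O.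
have [muj jmin] : 0 < mu j /\ forall i, 0 < mu i -> w j / mu j <= w i / mu i.
  by rewrite /j; case: arg_minP.
pose t := w j / mu j.
have t0 : 0 <= t by rewrite divr_ge0 // ltW.
pose w1 i := w i - t * mu i.
have w1S i : i \notin support_of w -> w1 i = 0.
  move=> iS; rewrite /w1 muS // mulr0 subr0.
  by move: iS; rewrite inE negbK => /eqP.
have [||w2 [w20 w2N w2s w2a]] := IH w1.
- rewrite -ltnS; apply: leq_trans wn; rewrite ltnS; apply: proper_card.
  apply/fintype.properP; split.
    apply/fintype.subsetP => i; rewrite inE; apply: contraR => /w1S ->; exact/eqP.
  exists j; last by rewrite inE negbK /w1 /t divfK ?subrr // gt_eqF.
  by apply: contraTT muj => /muS ->; rewrite ltxx.
- move=> i; rewrite /w1 subr_ge0; have [mi|mi] := ltP 0 (mu i).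
    by rewrite -ler_pdivlMr // jmin.
  by apply: le_trans (w0 i); rewrite mulr_ge0_le0.
exists w2; split => //.
  by rewrite w2s /w1 sumrB -mulr_sumr mu1 mulr0 subr0.
rewrite w2a /w1; under eq_bigr do rewrite rmorphB rmorphM scalerBl -scalerA.
by rewrite sumrB -scaler_sumr mua scaler0 subr0.
Qed.

(** * Real scalars and norm bounds *)

Section RealScalars.

(** The last two properties of [iota] hold for the identity of R and for the
    embedding of R into R[i], whose nonnegative elements are real; they let
    norms and convex weights be read as real numbers. *)
Context (R : realType) (K : numFieldType) (iota : {rmorphism R -> K}).
Context (iota_ge0 : forall t, 0 <= t -> 0 <= iota t).
Context (iota_onto : forall k : K, 0 <= k -> exists2 t, 0 <= t & k = iota t).

Lemma iota_le s t : s <= t -> iota s <= iota t.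
Proof. by move=> st; rewrite -subr_ge0 -rmorphB iota_ge0 // subr_ge0. Qed.

Lemma norm_iotaZ (E : normedModType K) t (x : E) M :
  0 <= t -> `|x| <= iota M -> `|iota t *: x| <= iota (t * M).
Proof.
move=> t0 xM; rewrite normrZ rmorphM ger0_norm ?iota_ge0 //.
by rewrite ler_wpM2l // iota_ge0.
Qed.

Lemma bounded_setE (E : normedModType K) (A : set E) :
  A !=set0 ->
  bounded_set A <-> exists2 M, 0 <= M & forall x, A x -> `|x| <= iota M.
Proof.
move=> [x0 Ax0]; split.
  move=> /pinfty_ex_gt0[M M0 AM].
  have [t t0 tM] := iota_onto (ltW M0); exists t => // x Ax.
  by rewrite -tM; exact: AM.
move=> [M M0 AM]; exists (iota M); split; first exact/ger0_real/iota_ge0.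
by move=> k Mk x Ax; apply: le_trans (AM x Ax) (ltW Mk).
Qed.

(** * Rounding weights to integers *)

Fixpoint sumset (V : zmodType) (A : set V) (n : nat) : set V :=
  if n is m.+1 then set_add (sumset A m) A else [set 0].

(** The rounding is done greedily, by induction on [n]. As long as [n] is at
    least [m], some weight is at least 1, and one
    copy of its vector can be moved to [s] without any error. The at most [m]
    units of weight left at the end contribute at most [m * M], and so do the
    arbitrary points of [A] that replace them. *)
Lemma sumset_approximation (E : normedModType K) (A : set E) (M : R)
    (I : finType) (a : I -> E) (m n : nat) (w : I -> R) :
  0 <= M -> A !=set0 -> (forall x, A x -> `|x| <= iota M) ->
  (forall i, A (a i)) -> (forall i, 0 <= w i) ->
  (#|support_of w| <= m)%N -> \sum_i w i = n%:R ->
  exists2 s, sumset A n s &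
    `|\sum_i iota (w i) *: a i - s| <= iota ((m + m)%:R * M).
Proof.
move=> M0 [a0 Aa0] AM Aa; elim: n w => [|n IH] w w0 wm wn.
  exists 0 => //; rewrite subr0 big1 ?normr0 ?iota_ge0 ?mulr_ge0 // => i _.
  have /eqP := wn; rewrite psumr_eq0 // => /allP/(_ i (mem_index_enum _)).
  by move=> /eqP ->; rewrite rmorph0 scale0r.
have [mn|nm] := leqP m n.+1; last first.
  (* Few units remain: any [n.+1] points of [A] will do. *)
  have As k : sumset A k (a0 *+ k).
    elim: k => [|k IHk] /=; first by rewrite mulr0n.
    by exists (a0 *+ k) => //; exists a0 => //; rewrite mulrSr.
  exists (a0 *+ n.+1); first exact: As.
  apply: le_trans (ler_normB _ _) _.
  rewrite natrD mulrDl rmorphD lerD //;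
    apply: (@le_trans _ _ (iota (n.+1%:R * M))).
  - apply: le_trans (ler_norm_sum _ _ _) _.
    rewrite -wn mulr_suml rmorph_sum; apply: ler_sum => i _.
    by apply: norm_iotaZ => //; exact/AM/Aa.
  - by apply: iota_le; rewrite ler_wpM2r // ler_nat ltnW.
  - rewrite -scaler_nat -(rmorph_nat iota); apply: norm_iotaZ => //; exact: AM.
  - by apply: iota_le; rewrite ler_wpM2r // ler_nat ltnW.
(* Otherwise all weights are below 1 and their sum is less than [m]. *)
have [i wi1] : exists i, 1 <= w i.
  apply/existsP; apply: contraT => /existsPn wlt1.
  have : \sum_i w i < \sum_(i in support_of w) 1.
    rewrite (bigID (mem (support_of w))) /= [X in _ + X]big1 ?addr0; last first.
      by move=> i; rewrite inE negbK => /eqP.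
    have [S0|[i iS]] := set_0Vmem (support_of w).
      move: wn; rewrite (bigID (mem (support_of w))) /= S0 big_set0 add0r.
      rewrite big1 => [/esym/eqP|i]; first by rewrite pnatr_eq0.
      by move=> _; apply/eqP; have := finset.in_set0 i; rewrite -S0 inE; case: eqP.
    rewrite (bigD1 i) //= [ltRHS](bigD1 i) //=.
    apply: ltr_leD; first by rewrite ltNge wlt1.
    by apply: ler_sum => k _; rewrite ltW // ltNge wlt1.
  rewrite wn sumr_const ltr_nat ltnNge => /negP[].
  exact: leq_trans wm mn.
pose w1 k := w k - (k == i)%:R.
have [|||s As sw] := IH w1.
- move=> k; rewrite /w1; case: eqP => [->|_]; first by rewrite subr_ge0.
  by rewrite subr0.
- apply: leq_trans wm; apply: subset_leq_card; apply/fintype.subsetP => k.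
  rewrite !inE /w1; case: (k =P i) => [->|_]; last by rewrite subr0.
  by move=> _; rewrite gt_eqF // (lt_le_trans ltr01).
- rewrite /w1 sumrB wn (bigD1 i (F := fun k => (k == i)%:R)) //= eqxx.
  rewrite [X in 1 + X]big1 ?addr0 => [|k /negbTE ->//].
  by rewrite -natr1 addrK.
exists (s + a i); first by exists s => //; exists (a i).
rewrite (_ : _ - _ = \sum_k iota (w1 k) *: a k - s) //.
rewrite /w1; under [in RHS]eq_bigr do rewrite rmorphB scalerBl.
rewrite sumrB [X in _ = _ - X - s](bigD1 i) //= eqxx rmorph1 scale1r.
rewrite [X in _ = _ - (_ + X) - s]big1 => [|k /negbTE ->]; last first.
  by rewrite rmorph0 scale0r.
by rewrite addr0 opprD addrA addrAC.
Qed.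

(** * Convex hulls and averages *)

Definition convex_combination (E : lmodType K) (A : set E) : set E :=
  [set x | exists (I : finType) (a : I -> E) (w : I -> R),
    [/\ forall i, A (a i), forall i, 0 <= w i, \sum_i w i = 1 &
        x = \sum_i iota (w i) *: a i]].

Lemma i01_iota (k : {i01 K}) :
  exists2 t, 0 <= t <= 1 & k%:num = iota t.
Proof.
have [t t0 kt] := iota_onto (ge0 k).
have [s s0 ks] : exists2 s, 0 <= s & 1 - k%:num = iota s.
  by apply: iota_onto; rewrite subr_ge0.
exists t => //; rewrite t0 /= -subr_ge0.
rewrite (_ : 1 - t = s) //; apply: (fmorph_inj iota).
by rewrite rmorphB rmorph1 -ks kt.
Qed.

(** Convex combinations of points of [A] form a convex set: two families are
    put side by side, indexed by the sum of the index types. *)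
Lemma convex_hull_sub_combination (E : lmodType K) (A : set E) :
  convex_hull A `<=` convex_combination A.
Proof.
apply: smallest_sub; last first.
  move=> x Ax; exists unit, (fun=> x), (fun=> 1); split => //.
    by rewrite big_const card_unit /= addr0.
  by rewrite big_const card_unit /= addr0 rmorph1 scale1r.
move=> x y k; rewrite !inE.
move=> -[I [a [w [Aa w0 w1 ->]]]] [J [b [v [Ab v0 v1 ->]]]].
have [t /andP[t0 t1] kt] := i01_iota k.
exists (I + J)%type, (fun i => match i with inl i => a i | inr j => b j end).
exists (fun i => match i with inl i => t * w i | inr j => (1 - t) * v j end).
split.
- by case.
- by case=> ?; rewrite mulr_ge0 // subr_ge0.
- by rewrite big_sumType /= -!mulr_sumr w1 v1 !mulr1 addrC subrK.
- have sumZ (L : finType) s (u : L -> R) (c : L -> E) :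
      \sum_l iota (s * u l) *: c l = iota s *: \sum_l iota (u l) *: c l.
    by rewrite scaler_sumr; apply: eq_bigr => l _; rewrite rmorphM scalerA.
  by rewrite big_sumType /= !sumZ rmorphB rmorph1 -kt.
Qed.

Lemma convex_hull_norm_le (E : normedModType K) (A : set E) (M : R) :
  (forall x, A x -> `|x| <= iota M) ->
  forall x, convex_hull A x -> `|x| <= iota M.
Proof.
move=> AM x /convex_hull_sub_combination[I [a [w [Aa w0 w1 ->]]]].
apply: le_trans (ler_norm_sum _ _ _) _.
rewrite -[M]mul1r -w1 mulr_suml rmorph_sum; apply: ler_sum => i _.
by apply: norm_iotaZ => //; exact: AM.
Qed.

Definition average (E : lmodType K) (A : set E) (n : nat) : set E :=
  set_scale (iota n%:R^-1) (sumset A n).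

Lemma average_norm_le (E : normedModType K) (A : set E) (M : R) (n : nat) :
  0 <= M -> (forall x, A x -> `|x| <= iota M) ->
  forall x, average A n x -> `|x| <= iota M.
Proof.
move=> M0 AM x [s As <-].
have sM : `|s| <= iota (n%:R * M).
  elim: n s As => [|n IH] s /=.
    by move=> ->; rewrite normr0 mul0r rmorph0.
  case=> u Au [v Av <-]; apply: le_trans (ler_normD _ _) _.
  by rewrite -natr1 mulrDl mul1r rmorphD lerD ?IH ?AM.
apply: le_trans (norm_iotaZ _ sM) _; first by rewrite invr_ge0.
apply: iota_le; case: n {As sM} => [|n]; first by rewrite mul0r mulr0.
by rewrite mulKf // pnatr_eq0.
Qed.

Lemma average_nonempty (E : lmodType K) (A : set E) n :
  A !=set0 -> average A n !=set0.
Proof.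
move=> [a0 Aa0]; suff [s As] : sumset A n !=set0.
  by exists (iota n%:R^-1 *: s); exists s.
elim: n => [|n [s As]]; first by exists 0.
by exists (s + a0); exists s => //; exists a0.
Qed.

Lemma bounded_family_average (E : normedModType K) (A : set E) n :
  bounded_family A -> bounded_family (average A n).
Proof.
move=> [A0 /(bounded_setE A0)[M M0 AM]].
have avg0 := average_nonempty n A0.
split=> //; apply/(bounded_setE avg0); exists M => //.
exact: average_norm_le.
Qed.

(** The average of [n + 2] copies of [A] is the convex combination, with
    weights (n + 1) / (n + 2) and 1 / (n + 2), of the average of [n + 1] copies
    and [A]. *)
Lemma nu_average_le (E : normedModType K) (nu : set E -> R) (A : set E) n :
  A2 nu -> A4 iota nu -> bounded_family A -> nu (average A n.+1) <= nu A.
Proof.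
move=> nu2 nu4 bA.
have bavg k : bounded_family (average A k) by exact: bounded_family_average.
elim: n => [|n IH].
  apply: nu2 => // x [_ [_ -> [u Au <-]] <-].
  by rewrite add0r invr1 rmorph1 scale1r.
pose t : R := n.+1%:R / n.+2%:R.
have n2 : (n.+2%:R : R) != 0 by rewrite pnatr_eq0.
have n1 : (n.+1%:R : R) != 0 by rewrite pnatr_eq0.
have tE : 1 - t = n.+2%:R^-1.
  by apply: (mulIf n2); rewrite mulVf // mulrBl mul1r divfK // -natrB // subSnn.
have t01 : 0 <= t <= 1.
  by rewrite divr_ge0 //= -subr_ge0 tE invr_ge0.
set T := set_add (set_scale (iota t) (average A n.+1))
  (set_scale (iota (1 - t)) A).
have avgE : average A n.+2 = T.
  have E1 (u v : E) : iota n.+2%:R^-1 *: (u + v) =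
      iota t *: (iota n.+1%:R^-1 *: u) + iota (1 - t) *: v.
    by rewrite scalerDr tE scalerA -rmorphM /t mulrAC divff // mul1r.
  apply/seteqP; split => x.
    case=> _ [u Au [v Av <-]] <-; rewrite E1.
    exists (iota t *: (iota n.+1%:R^-1 *: u)).
      by exists (iota n.+1%:R^-1 *: u) => //; exists u.
    by exists (iota (1 - t) *: v) => //; exists v.
  case=> _ [_ [u Au <-] <-] [_ [v Av <-] <-]; rewrite -E1.
  by exists (u + v) => //; exists u => //; exists v.
rewrite avgE; apply: le_trans (nu4 _ _ _ (bavg _) bA t01) _.
case/andP: t01 => t0 _; have := ler_wpM2l t0 IH; lra.
Qed.

(** This is where the dimension matters: the bound depends neither on [x] nor
    on [n], since the number of points in play is at most N + 1. *)
Lemma convex_hull_near_average (E : normedModType K) (A : set E) (M : R) N n :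
  real_spanned iota E N -> 0 <= M -> A !=set0 ->
  (forall x, A x -> `|x| <= iota M) ->
  forall x, convex_hull A x -> exists2 y, average A n.+1 y &
    `|iota n.+1%:R *: (x - y)| <= iota ((N.+1 + N.+1)%:R * M).
Proof.
move=> spE M0 A0 AM x /convex_hull_sub_combination[I [a [w [Aa w0 w1 ->]]]].
have [w' [w'0 w'N w's <-]] := caratheodory a spE w0.
have [|||s As sE] := @sumset_approximation E A M I a N.+1 n.+1
  (fun i => n.+1%:R * w' i) M0 A0 AM Aa.
- by move=> i; rewrite mulr_ge0.
- apply: leq_trans w'N; apply: subset_leq_card; apply/fintype.subsetP => i.
  by rewrite !inE mulf_eq0 negb_or => /andP[].
- by rewrite -mulr_sumr w's w1 mulr1.
exists (iota n.+1%:R^-1 *: s); first by exists s.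
rewrite scalerBr scalerA -rmorphM divff ?pnatr_eq0 // rmorph1 scale1r.
rewrite scaler_sumr; under eq_bigr do rewrite scalerA -rmorphM.
exact: sE.
Qed.

(** * Invariance under convex hulls *)

Lemma A2_A4_convex_hull (E : normedModType K) (nu : set E -> R) N :
  real_spanned iota E N -> A2 nu -> A4 iota nu -> A3 nu.
Proof.
move=> spE nu2 nu4 A bA; have [A0 /(bounded_setE A0)[M M0 AM]] := bA.
have [a0 Aa0] := A0.
have AC : A `<=` convex_hull A by exact: sub_gen_smallest.
have C0 : convex_hull A !=set0 by exists a0; exact: AC.
have bC : bounded_family (convex_hull A).
  split=> //; apply/(bounded_setE C0); exists M => //.
  exact: convex_hull_norm_le.
apply/eqP; rewrite eq_le (nu2 A) // andbT.
(* The radius of a ball containing all the points [y + n.+1 (x - y)]. *)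
set r := M + (N.+1 + N.+1)%:R * M.
have r0 : 0 <= r by rewrite addr_ge0 // mulr_ge0.
pose B : set E := [set x | `|x| <= iota r].
have B0 : B !=set0 by exists 0; rewrite /B /= normr0 iota_ge0.
have bB : bounded_family B.
  by split=> //; apply/(bounded_setE B0); exists r.
have step n : n.+1%:R * (nu (convex_hull A) - nu A) <= nu B - nu A.
  have bavg : bounded_family (average A n.+1) by exact: bounded_family_average.
  pose d : R := n.+1%:R^-1.
  have n0 : 0 < n.+1%:R :> R by rewrite ltr0n.
  have d01 : 0 <= 1 - d <= 1.
    by rewrite subr_ge0 gerBl invr_ge0 ler0n andbT invf_le1 // ler1n.
  pose T := set_add (set_scale (iota (1 - d)) (average A n.+1))
      (set_scale (iota (1 - (1 - d))) B).
  have CT : convex_hull A `<=` T.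
    move=> x /(convex_hull_near_average n spE M0 A0 AM)[y Ay xy].
    exists (iota (1 - d) *: y); first by exists y.
    exists (iota (1 - (1 - d)) *: (y + iota n.+1%:R *: (x - y))).
      exists (y + iota n.+1%:R *: (x - y)) => //.
      apply: le_trans (ler_normD _ _) _; rewrite rmorphD lerD //.
      exact: average_norm_le Ay.
    rewrite subKr scalerDr scalerA -rmorphM mulVf ?gt_eqF // rmorph1 scale1r.
    by rewrite addrA -scalerDl -rmorphD subrK rmorph1 scale1r addrC subrK.
  have bT : bounded_family T.
    have T0 : T !=set0.
      by have [x Cx] := C0; exists x; exact: CT.
    split=> //; apply/(bounded_setE T0); exists ((1 - d) * M + (1 - (1 - d)) * r).
      by case/andP: d01 => ? ?; rewrite addr_ge0 ?mulr_ge0 // subr_ge0.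
    case/andP: d01 => d0 d1.
    move=> _ [_ [y Ay <-] [_ [z Bz <-] <-]].
    apply: le_trans (ler_normD _ _) _; rewrite [leRHS]rmorphD lerD // norm_iotaZ //.
      exact: average_norm_le Ay.
    by rewrite subr_ge0.
  have := le_trans (nu2 _ _ bC bT CT) (nu4 _ _ _ bavg bB d01).
  have := nu_average_le n nu2 nu4 bA.
  case/andP: d01 => d0 d1 avgA CB.
  rewrite -ler_pdivlMl // -/d.
  have := ler_wpM2l d0 avgA; lra.
(* A positive gap would make the left-hand side of [step] unbounded in [n]. *)
rewrite leNgt -subr_gt0; apply/negP => gap.
have := step (Num.truncn ((nu B - nu A) / (nu (convex_hull A) - nu A))).
rewrite -ler_pdivlMr // leNgt => /negP; apply.
exact: truncnS_gt.
Qed.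

End RealScalars.

Theorem corollary27 (R : realType) :
  (forall (E : completeNormedModType R) (nu : set E -> R),
     finite_dimensional E -> nonneg_on_bounded nu ->
     A1 nu -> A2 nu -> A4 idfun nu -> A5 nu -> A3 nu)
  /\
  (forall (E : completeNormedModType R[i]) (nu : set E -> R),
     finite_dimensional E -> nonneg_on_bounded nu ->
     A1 nu -> A2 nu -> A4 (real_complex R) nu -> A5 nu -> A3 nu).
Proof.
split=> E nu [n [b bE]] _ _ nu2 nu4 _.
  apply: (@A2_A4_convex_hull R R idfun _ _ E nu n) => //.
    by move=> k k0; exists k.
  by exists b.
apply: (@A2_A4_convex_hull R R[i] (real_complex R) _ _ E nu (n + n)) => //.
- by move=> t t0; rewrite -(rmorph0 (real_complex R)) lecR.
- move=> k; rewrite lecE /= => /andP[/eqP k0 kge0]; exists (complex.Re k) => //.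
  by case: k k0 {kge0} => x y /= ->.
(* Each complex coefficient splits into its real and imaginary parts. *)
exists (fun j : 'I_(n + n) => match fintype.split j with
  inl i => b i | inr i => 'i *: b i end).
move=> x; have [c ->] := bE x.
exists (fun j : 'I_(n + n) => match fintype.split j with
  inl i => complex.Re (c i) | inr i => complex.Im (c i) end).
rewrite big_split_ord /= -big_split /=; apply: eq_bigr => i _.
have -> : fintype.split (lshift n i) = inl i by exact: (unsplitK (inl i)).
have -> : fintype.split (rshift n i) = inr i by exact: (unsplitK (inr i)).
by rewrite scalerA -scalerDl [in LHS](complexE (c i)) mulrC.
Qed.
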